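(* Let $\theta>0$ and let $n\ge 1$ be an integer. Let $X_1,\dots,X_n$ be a random sample (i.i.d.) of size $n$ from the Lomax distribution with parameter $\theta$, and let $R_1,\dots,R_n$ be the first $n$ upper record values from the Lomax distribution with parameter $\theta$. Put $$\hat\theta_{\mathrm{Sample};n}=\frac{1}{n}\sum_{i=1}^n \ln(1+X_i),\qquad \hat\theta_{\mathrm{Records};n}=\frac{\ln(1+R_n)}{n}.$$ Let $g:(0,\infty)\to\mathbb{R}$ be a one-to-one (Borel measurable) function. Then: (I) $g(\hat\theta_{\mathrm{Records};n})$ and $g(\hat\theta_{\mathrm{Sample};n})$ have the same distribution. (II) $\mathrm{MSE}[g(\hat\theta_{\mathrm{Records};n})]=\mathrm{MSE}[g(\hat\theta_{\mathrm{Sample};n})]$, where the mean square errors are those of these statistics as estimators of $g(\theta)$.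
   Context: The Lomax distribution with parameter $\theta>0$ has probability density function $f(x;\theta)=\frac1\theta(1+x)^{-(\frac1\theta+1)}$ for $x\ge 0$ (and $0$ for $x<0$) and cumulative distribution function $F(x;\theta)=1-(1+x)^{-1/\theta}$ for $x\ge0$. Upper record values: for an infinite i.i.d. sequence $Y_1,Y_2,\dots$ from a continuous distribution, set $T_1=1$, $T_{k+1}=\min\{j>T_k: Y_j>Y_{T_k}\}$ (almost surely finite for the Lomax distribution), and $R_k=Y_{T_k}$; $R_k$ is the $k$-th upper record value. The joint density of $(R_1,\dots,R_m)$ is $f(r_m;\theta)\prod_{i=1}^{m-1}\frac{f(r_i;\theta)}{1-F(r_i;\theta)}$ on $0\le r_1<\dots<r_m$. $\hat\theta_{\mathrm{Sample};n}$ and $\hat\theta_{\mathrm{Records};n}$ are the maximum likelihood estimators of $\theta$ based on the random sample and on the records respectively; both are almost surely positive. For a statistic $S$ used to estimate a quantity $A(\theta)$, $\mathrm{MSE}(S)=E[(S-A(\theta))^2]\in[0,\infty]$. *)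

(* Defs.v *)
From mathcomp Require Import all_boot all_order all_algebra.
From mathcomp Require Import all_classical all_reals all_analysis.
Import Order.TTheory GRing.Theory Num.Theory.
Import numFieldNormedType.Exports.

Set Implicit Arguments.
Unset Strict Implicit.
Unset Printing Implicit Defensive.

Local Open Scope classical_set_scope.
Local Open Scope ring_scope.

Definition lomax_pdf (R : realType) (theta : R) : R -> R :=
  (fun x => theta^-1 * (1 + x) `^ (- (theta^-1 + 1))) \_ `[0, +oo[.

Definition lomax_prob (R : realType) (theta : R) (B : set R) : \bar R :=
  (\int[lebesgue_measure]_(x in B) (lomax_pdf theta x)%:E)%E.

Definition has_lomax_law (d : measure_display) (T : measurableType d)
    (R : realType) (P : probability T R) (theta : R) (X : {RV P >-> R}) : Prop :=
  forall B : set R, measurable B -> distribution P X B = lomax_prob theta B.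

Definition mutually_independent (d : measure_display) (T : measurableType d)
    (R : realType) (P : probability T R) (I : eqType)
    (X : I -> {RV P >-> R}) : Prop :=
  forall (J : seq I) (B : I -> set R), uniq J ->
    (forall i, i \in J -> measurable (B i)) ->
    P (\bigcap_(i in [set` J]) X i @^-1` B i)
      = (\prod_(i <- J) P (X i @^-1` B i))%E.

Definition iid_lomax (d : measure_display) (T : measurableType d)
    (R : realType) (P : probability T R) (theta : R) (I : eqType)
    (X : I -> {RV P >-> R}) : Prop :=
  mutually_independent X /\ forall i, has_lomax_law theta (X i).

(* The observations are y 0, y 1, ... (the first one has index 0).  If no
   observation after time t exceeds y t, there is no next record and the
   value t is a dummy; under a continuous law with unbounded support, such as
   Lomax, this happens with probability 0. *)
Definition next_record_time (R : realType) (y : nat -> R) (t : nat) : nat :=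
  if pselect (exists j, (t < j)%N && (y t < y j)) is left h
  then ex_minn h else t.

(* k-th record time and value, numbered from k = 1 ; k = 0 is a dummy. *)
Definition record_time (R : realType) (y : nat -> R) (k : nat) : nat :=
  iter k.-1 (next_record_time y) 0%N.

Definition record_value (R : realType) (y : nat -> R) (k : nat) : R :=
  y (record_time y k).

Definition theta_sample (T : Type) (R : realType) (n : nat)
    (X : 'I_n -> T -> R) (w : T) : R :=
  n%:R^-1 * \sum_(i < n) ln (1 + X i w).

Definition theta_records (T : Type) (R : realType) (n : nat)
    (Y : nat -> T -> R) (w : T) : R :=
  ln (1 + record_value (fun i => Y i w) n) / n%:R.

Definition same_distribution (d d' : measure_display)
    (T : measurableType d) (T' : measurableType d') (R : realType)
    (P : probability T R) (P' : probability T' R)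
    (S : T -> R) (S' : T' -> R) : Prop :=
  [/\ measurable_fun setT S, measurable_fun setT S' &
      forall B : set R, measurable B -> pushforward P S B = pushforward P' S' B].

Definition mse (d : measure_display) (T : measurableType d) (R : realType)
    (P : probability T R) (S : T -> R) (a : R) : \bar R :=
  ('E_P[fun w => ((S w - a) ^+ 2)%R])%E.

(* A function g on (0, +oo) composed with an estimator S of a positive
   parameter. S is positive only almost surely, so g is extended by 0; the
   extension is measurable and irrelevant up to a null event. *)
Definition comp_pos (T : Type) (R : realType) (g : R -> R) (S : T -> R)
    : T -> R :=
  (g \_ `]0, +oo[) \o S.

(* Main.v *)
From HB Require Import structures.
Require Import Defs.
From mathcomp Require Import all_boot all_order all_algebra.
From mathcomp Require Import all_classical all_reals all_analysis.
From mathcomp Require Import measurable_realfun.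
Import Order.TTheory GRing.Theory Num.Theory.
Import numFieldNormedType.Exports.

Set Implicit Arguments.
Unset Strict Implicit.
Unset Printing Implicit Defensive.

Local Open Scope classical_set_scope.
Local Open Scope ring_scope.

(** Both estimators are [ln (1 + r) / n], evaluated at the record [R_n] and,
    outside a null event, at [prod_i (1 + X_i) - 1].  So it suffices that these
    two variables have the same law ([same_distribution_theta]): composing with
    a measurable function preserves equality of laws
    ([same_distribution_comp]), and a mean square error depends on the law
    only ([same_distribution_mse]).

    The reason is that the Lomax tail [P (Y > y) = (1 + y) `^ (- theta^-1)] is
    multiplicative in [1 + y].  Given [Y > v >= 0], the variable [1 + Y] is
    therefore distributed as [(1 + v) (1 + Z)] with [Z] a fresh Lomax variable
    ([lomax_memoryless]).  Hence every new record multiplies [1 + R] by an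
    independent copy of [1 + Y], and [1 + R_n] is distributed as a product of
    [n] independent such factors.

    To carry this out without conditioning on random times, consider two
    Markov chains with states [(k, v)], where [k] counts what is still to come
    and [v] is the current value, both started at [(n, 0)] and driven by the
    observations.  The product chain replaces [v] by [(1 + v) (1 + y) - 1] at
    each observation [y]; the record chain replaces [v] by [y] when [y > v] and
    stays where it is otherwise; in both cases [k] drops by one when [v] is
    replaced, and [k = 0] is absorbing.  For a test function [f] let [u k v] be
    the mean of [f] after [k] further multiplications, starting at [v].  It is
    harmonic for the product chain by construction and for the record chain by
    the memoryless property ([record_step_harmonic]), so its mean is constant
    along either chain ([chain_harmonic]).  After [n] observations the product
    chain gives the mean of [f] at [prod_i (1 + X_i) - 1]; the record chain is
    almost surely absorbed at [(0, R_n)] because the observations are unbounded,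
    and bounded convergence gives the mean of [f] at [R_n].  Both are equal to
    [u n 0]. *)

(** * The Lomax tail *)

Section lomax_law.
Context (R : realType) (theta : R).
Hypothesis theta_gt0 : 0 < theta.

Lemma is_derive_shift_powR (a x : R) : 0 < 1 + x ->
  is_derive x 1 (fun x => (1 + x) `^ a) (a * (1 + x) `^ (a - 1)).
Proof.
move=> x0.
have dp : is_derive (1 + x) 1 (fun y : R => y `^ a) (a * (1 + x) `^ (a - 1)).
  exact: is_derive1_powR.
have ds : is_derive x 1 (fun x : R => 1 + x) 1.
  by rewrite -[X in is_derive _ _ _ X]add0r; exact: is_deriveD.
by apply: is_derive_eq (is_derive1_comp dp ds) _; rewrite mulr1.
Qed.

Lemma is_derive_lomax_tail (x : R) : 0 < 1 + x ->
  is_derive x 1 (fun x => - (1 + x) `^ (- theta^-1))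
    (theta^-1 * (1 + x) `^ (- (theta^-1 + 1))).
Proof.
move=> x0; have h := is_derive_shift_powR (- theta^-1) x0.
by apply: is_derive_eq (is_deriveN h) _; rewrite mulNr opprK opprD.
Qed.

Lemma lomax_tail_cvg0 : (1 + x) `^ (- theta^-1) @[x --> +oo] --> (0 : R).
Proof.
apply/cvgrPdist_le => e e0; near=> x.
have x0 : 0 < 1 + x.
  by rewrite addrC ltr_wpDl//; near: x; exact: nbhs_pinfty_ge.
rewrite sub0r normrN ger0_norm ?powR_ge0// powRN.
rewrite -[leRHS]invrK lef_pV2 ?posrE ?invr_gt0 ?powR_gt0//.
(* The tail is at most [e] as soon as [x] is above [e^-1 `^ theta]. *)
have -> : e^-1 = (e^-1 `^ theta) `^ theta^-1.
  by rewrite -powRrM mulfV ?gt_eqF// powRr1// invr_ge0 ltW.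
apply: ge0_ler_powR.
- by rewrite invr_ge0 ltW.
- by rewrite nnegrE powR_ge0.
- by rewrite nnegrE ltW.
- by rewrite (le_trans (y := x))// ?lerDr//; near: x; exact: nbhs_pinfty_ge.
Unshelve. all: by end_near. Qed.

Lemma lomax_prob_tail (a : R) : 0 <= a ->
  lomax_prob theta `]a, +oo[ = ((1 + a) `^ (- theta^-1))%:E.
Proof.
move=> a0.
have pos x : a <= x -> 0 < 1 + x by move=> ax; rewrite ltr_pwDl// (le_trans a0).
have dF x : a <= x -> is_derive x 1 (fun x => - (1 + x) `^ (- theta^-1))
    (theta^-1 * (1 + x) `^ (- (theta^-1 + 1))).
  by move=> /pos; exact: is_derive_lomax_tail.
have cf : {within `[a, +oo[, continuous
    (fun x : R => theta^-1 * (1 + x) `^ (- (theta^-1 + 1)))}.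
  apply: derivable_within_continuous => x; rewrite in_itv/= andbT => /pos x0.
  apply: derivableM => //.
  have h := is_derive_shift_powR (- (theta^-1 + 1)) x0; exact: ex_derive.
rewrite /lomax_prob.
under eq_integral => x.
  rewrite inE/= in_itv/= andbT => ax.
  rewrite /lomax_pdf patchE mem_set; last by rewrite /= in_itv/= andbT (le_trans a0)// ltW.
  over.
rewrite integral_itv_obnd_cbnd; last first.
  apply/measurable_EFinP; apply: subspace_continuous_measurable_fun => //.
  by apply: continuous_subspaceW cf; apply: subset_itvr; rewrite bnd_simp.
rewrite (@ge0_continuous_FTC2y _ _ (fun x => - (1 + x) `^ (- theta^-1)) _ 0)//.
- by rewrite sub0e EFinN oppeK.
- by move=> x _; rewrite mulr_ge0 ?powR_ge0// invr_ge0 ltW.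
- by rewrite -oppr0; apply: cvgN; exact: lomax_tail_cvg0.
- by move=> x /ltW /dF h; exact: ex_derive.
- apply: cvg_at_right_filter; have h := dF _ (lexx a).
  have /derivable1_diffP/differentiable_continuous :
    derivable (fun x : R => - (1 + x) `^ (- theta^-1)) a 1 by exact: ex_derive.
  exact.
- move=> x; rewrite in_itv/= andbT => /ltW /dF h.
  by rewrite derive1E; exact: derive_val.
Qed.

Lemma lomax_prob_lt0 : lomax_prob theta `]-oo, 0[ = 0%E.
Proof.
rewrite /lomax_prob integral0_eq// => x; rewrite /= in_itv/= => x0.
by rewrite /lomax_pdf patchE memNset//= in_itv/= andbT; apply/negP; rewrite -ltNge.
Qed.

End lomax_law.

(** * The multiplicative memoryless property *)

(** The value [r] with [1 + r = (1 + v) (1 + y)].  Truncating [v] at [0] makes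
    this multiplication correct for every real [v]: conditioning a nonnegative
    variable on exceeding a negative threshold does nothing. *)
Definition lomax_shift (R : realType) (v y : R) : R :=
  (1 + Num.max v 0) * (1 + y) - 1.

Lemma ge0_integral_mrestr d (T : measurableType d) (R : realType)
    (mu : {measure set T -> \bar R}) (D : set T) (mD : measurable D)
    (f : T -> \bar R) :
  measurable_fun setT f -> (forall x, 0 <= f x)%E ->
  (\int[mrestr mu mD]_x f x = \int[mu]_(x in D) f x)%E.
Proof.
move=> mf f0.
rewrite (@ge0_negligible_integral _ _ _ (mrestr mu mD) setT (~` D))//=.
- rewrite setTD setCK; apply: eq_measure_integral => A mA AD /=.
  by rewrite /mrestr setIidl.
- by apply: measurableC.
- by rewrite /mrestr setICl measure0.
Qed.

Lemma measurable_lomax_shift (R : realType) :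
  measurable_fun setT (fun p : R * R => lomax_shift p.1 p.2).
Proof.
apply: measurable_funB => //; apply: measurable_funM; apply: measurable_funD => //.
exact: measurable_maxr.
Qed.

Lemma measurable_lomax_shiftr (R : realType) (v : R) :
  measurable_fun setT (lomax_shift v).
Proof.
exact: measurableT_comp (@measurable_lomax_shift R) (pair1_measurable v).
Qed.

HB.instance Definition _ (R : realType) (v : R) :=
  isMeasurableFun.Build _ _ _ _ (lomax_shift v) (measurable_lomax_shiftr v).

Section lomax_memoryless.
Context (R : realType) (theta : R) (L : probability R R).
Hypothesis theta_gt0 : 0 < theta.
Hypothesis L_lomax : forall B : set R, measurable B -> L B = lomax_prob theta B.

Lemma lomax_negative_null : L `]-oo, 0[%classic = 0%E.
Proof. by rewrite L_lomax// lomax_prob_lt0. Qed.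

(** Truncation at [0] gives one formula for all thresholds, negative ones
    included, which keeps the memoryless property free of case distinctions. *)
Lemma lomax_tail (a : R) :
  L `]a, +oo[%classic = ((1 + Num.max a 0) `^ (- theta^-1))%:E.
Proof.
have [a0|a0] := leP 0 a; first by rewrite L_lomax// lomax_prob_tail// max_l.
rewrite addr0 powR1; apply/eqP; rewrite eq_le probability_le1//=.
rewrite -[X in (X <= _)%E](@probability_setT _ _ _ L).
have -> : [set: R] = `]-oo, 0[%classic `|` `[0, +oo[%classic.
  apply/seteqP; split => // x _ /=; rewrite !in_itv/= andbT.
  by case: ltP; [left|right].
apply: (le_trans (measureU2 _ _ _)) => //.
rewrite [X in (X + _)%E]lomax_negative_null add0e; apply: le_measure; rewrite ?inE//.
by apply: subset_itvr; rewrite bnd_simp.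
Qed.

(** On half-lines the memoryless property is the multiplicativity of powers,
    because [1 + max v b = (1 + v) max ((1 + b) / (1 + v)) 1]. *)
Lemma lomax_memoryless_tail (v b : R) :
  L (`]v, +oo[%classic `&` `]b, +oo[%classic)
    = (L `]v, +oo[%classic * L (lomax_shift v @^-1` `]b, +oo[%classic))%E.
Proof.
have v1 : 0 < 1 + Num.max v 0 by rewrite ltr_pwDl// le_max lexx orbT.
have -> : `]v, +oo[%classic `&` `]b, +oo[%classic = `](Num.max v b), +oo[%classic :> set R.
  by apply/seteqP; split=> x /=; rewrite !in_itv/= !andbT gt_max => /andP.
have -> : lomax_shift v @^-1` `]b, +oo[%classic
    = `]((1 + b) / (1 + Num.max v 0) - 1), +oo[%classic.
  apply/seteqP; split=> x /=; rewrite !in_itv/= !andbT /lomax_shift;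
  by rewrite ltrBrDl ltrBlDl ltr_pdivrMr// mulrC.
rewrite !lomax_tail -EFinM -powRM ?ltW//; last first.
  by rewrite ltr_pwDl// le_max lexx orbT.
congr (_ `^ _)%:E.
have maxB1 (x : R) : 1 + Num.max (x - 1) 0 = Num.max x 1.
  by rewrite addr_maxr addrC subrK addr0.
rewrite maxB1 maxr_pMr ?ltW// mulrCA mulfV ?gt_eqF// !mulr1.
by rewrite !addr_maxr !addr0 maxA [in RHS](maxC (1 + b)) maxAC.
Qed.

(** The half-lines generate the Borel sets and are stable under
    intersection, so the previous identity between finite measures extends to
    all of them. *)
Lemma lomax_memoryless (v : R) (B : set R) : measurable B ->
  L (`]v, +oo[%classic `&` B) = (L `]v, +oo[%classic * L (lomax_shift v @^-1` B))%E.
Proof.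
have mv : measurable (`]v, +oo[%classic : set R) by [].
have k0 : 0 <= fine (L `]v, +oo[%classic) by rewrite fine_ge0.
have kE : (fine (L `]v, +oo[%classic))%:E = L `]v, +oo[%classic.
  by rewrite fineK// fin_num_measure.
move=> mB; rewrite setIC -kE.
pose m2 := mscale (NngNum k0) (distribution L (lomax_shift v)).
suff : mrestr L mv B = m2 B by [].
(* The half-lines above [- n] exhaust the real line. *)
apply: (measure_unique (@RGenOInfty.G R) (fun n => `](- n%:R), +oo[%classic)
  _ _ _ _ (mrestr L mv) m2) => //.
- exact: RGenOInfty.measurableE.
- move=> _ _ [x ->] [y ->]; exists (Num.max x y).
  by apply/seteqP; split=> z /=; rewrite !in_itv/= !andbT gt_max => /andP.
- by move=> n; exists (- n%:R).
- apply/seteqP; split => // x _; exists (Num.bound `|x|) => //=.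
  rewrite in_itv/= andbT ltrNl (le_lt_trans (ler_norm (- x)))// normrN.
  exact: archi_boundP.
- by move=> _ [b ->]; rewrite /m2/= /mrestr /mscale/= setIC kE lomax_memoryless_tail.
- by move=> n; rewrite /= /mrestr (le_lt_trans (probability_le1 _ _)) ?ltry//; exact: measurableI.
Qed.

(** Let [c] be the right-hand side.  Given that it exceeds [v], an observation
    has the law of [lomax_shift v Z] with [Z] Lomax, so the values above [v]
    contribute [L (v, oo) c]; the others contribute [L (-oo, v] c]. *)
Lemma integral_lomax_record (v : R) (h : R -> \bar R) :
  measurable_fun setT h -> (forall y, 0 <= h y)%E ->
  (\int[L]_y (if (v < y)%R then h y else \int[L]_z h (lomax_shift v z))
   = \int[L]_z h (lomax_shift v z))%E.
Proof.
move=> mh h0; pose D : set R := `]v, +oo[%classic; set c := (\int[L]_z h (lomax_shift v z))%E.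
have mD : measurable D by exact: measurable_itv.
have c0 : (0 <= c)%E by apply: integral_ge0 => z _; exact: h0.
have k0 : 0 <= fine (L D) by rewrite fine_ge0.
have kE : (fine (L D))%:E = L D by rewrite fineK// fin_num_measure.
pose m2 := mscale (NngNum k0) (distribution L (lomax_shift v)).
have intD : (\int[L]_(y in D) h y = L D * c)%E.
  rewrite -(ge0_integral_mrestr L mD mh h0).
  rewrite (eq_measure_integral m2); last first.
    move=> A mA _; rewrite /m2/= /mrestr /mscale/= setIC kE.
    exact: lomax_memoryless.
  rewrite ge0_integral_mscale//= kE; congr (_ * _)%E.
  by rewrite ge0_integral_pushforward//; exact: measurable_lomax_shiftr.
rewrite -(setUv D) ge0_integral_setU//=; last 4 first.
- by apply: measurableC.
- rewrite setUv; apply: measurable_fun_ifT => //.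
  by apply: measurable_fun_ltr.
- by move=> y _; case: ifP => _; [exact: h0|exact: c0].
- by apply/disj_setPCl.
rewrite (eq_integral h); last first.
  by move=> y; rewrite inE /D/= in_itv/= andbT => ->.
rewrite [X in (_ + X)%E](eq_integral (cst c)); last first.
  by move=> y; rewrite inE /D/= in_itv/= andbT => /negP/negbTE ->.
rewrite intD integral_cst//; last exact: measurableC.
rewrite [X in (X + _)%E]muleC -ge0_muleDr ?measure_ge0//.
rewrite -measureU//; [|exact: measurableC|by rewrite setICr].
rewrite [X in (c * X)%E](_ : _ = 1%E) ?mule1//.
by rewrite setUv; exact: (@probability_setT _ _ _ L).
Qed.

End lomax_memoryless.

(** * Markov chains driven by independent observations *)

Lemma eq_measure_rectangles d1 d2 (T1 : measurableType d1)
    (T2 : measurableType d2) (R : realType)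
    (m1 m2 : {measure set (T1 * T2) -> \bar R}) :
  (m1 setT < +oo)%E ->
  (forall A B, measurable A -> measurable B -> m1 (A `*` B) = m2 (A `*` B)) ->
  forall E, measurable E -> m1 E = m2 E.
Proof.
move=> m1y m12 E mE.
pose G : set (set (T1 * T2)) :=
  [set A `*` B | A in measurable & B in measurable].
apply: (measure_unique G (fun=> setT)) => //.
- exact: measurable_prod_measurableType.
- move=> _ _ [A mA [B mB <-]] [A' mA' [B' mB' <-]]; rewrite -setXI.
  by exists (A `&` A'); [exact: measurableI|exists (B `&` B') => //; exact: measurableI].
- by move=> _; exists setT => //; exists setT => //; rewrite setXTT.
- by rewrite bigcup_const//; exists 0%N.
- by move=> _ [A mA [B mB <-]]; exact: m12.
Qed.

(** The chain starts at the deterministic state [z]; [s] lists the indices of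
    the observations in the order in which they are fed to it. *)
Definition chain (S R T I : Type) (step : S -> R -> S) (z : S)
    (X : I -> T -> R) (s : seq I) (w : T) : S :=
  foldl step z [seq X i w | i <- s].

Lemma chain_rcons (S R T I : Type) (step : S -> R -> S) (z : S)
    (X : I -> T -> R) (s : seq I) (i : I) (w : T) :
  chain step z X (rcons s i) w = step (chain step z X s w) (X i w).
Proof. by rewrite /chain map_rcons foldl_rcons. Qed.

Section independent_chain.
Context (R : realType) d (T : measurableType d) (P : probability T R)
  (I : eqType) (X : I -> {RV P >-> R}).
Context dS (S : measurableType dS) (step : S -> R -> S) (z : S).
Hypothesis X_indep : mutually_independent X.
Hypothesis mstep : measurable_fun setT (fun p : S * R => step p.1 p.2).

Local Notation M := (chain step z X).

Lemma measurable_chain s : measurable_fun setT (M s).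
Proof.
elim/last_ind: s => [|s i ih]; first exact: measurable_cst.
rewrite (_ : M _ = (fun p => step p.1 p.2) \o (fun w => (M s w, X i w))).
  apply: measurableT_comp => //; apply: measurable_fun_pair => //.
by apply/funext => w; rewrite chain_rcons.
Qed.

(** The chain that has read the observations of [s] is independent of the
    others.  Independence is known for events [X i \in B i] only, so the
    induction feeds one observation at a time: as functions of an event on
    [(M s, X i)] both sides are finite measures, and on rectangles they agree
    by the induction hypothesis for [i :: J]. *)
Lemma chain_indep (s J : seq I) (A : set S) (B : I -> set R) :
  uniq (s ++ J) -> measurable A -> (forall i, measurable (B i)) ->
  P (M s @^-1` A `&` \bigcap_(i in [set` J]) X i @^-1` B i)
    = (P (M s @^-1` A) * \prod_(i <- J) P (X i @^-1` B i))%E.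
Proof.
elim/last_ind: s J A B => [|s i ih] J A B.
  rewrite cat0s => uJ mA mB; rewrite -(X_indep uJ); last by move=> j _.
  rewrite /chain/=; have [zA|zA] := pselect (A z).
    rewrite (_ : _ @^-1` A = setT) ?setTI ?probability_setT ?mul1e//.
    by apply/seteqP; split.
  rewrite (_ : _ @^-1` A = set0) ?set0I ?measure0 ?mul0e//.
  by apply/seteqP; split.
rewrite cat_rcons => uJ mA mB.
have mX j (C : set R) : measurable C -> measurable (X j @^-1` C).
  by move=> mC; rewrite -[X in measurable X]setTI; exact: measurable_funP.
have mM (C : set S) : measurable C -> measurable (M s @^-1` C).
  by move=> mC; rewrite -[X in measurable X]setTI; exact: measurable_chain.
have mbig (J' : seq I) : measurable (\bigcap_(j in [set` J']) X j @^-1` B j).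
  apply: fin_bigcap_measurable; first exact: finite_seq.
  by move=> j _; exact: mX.
have rect (J' : seq I) C E : uniq (s ++ i :: J') ->
    measurable C -> measurable E ->
    P (M s @^-1` C `&` X i @^-1` E `&` \bigcap_(j in [set` J']) X j @^-1` B j) =
    (P (M s @^-1` C) * P (X i @^-1` E) *
      P (\bigcap_(j in [set` J']) X j @^-1` B j))%E.
  move=> uJ' mC mE.
  (* The induction hypothesis for [i :: J'], with the event [E] put at [i]. *)
  pose B' j := if j == i then E else B j.
  have /and3P[_ _ /andP[iJ uJ'']] : [&& uniq s, ~~ has (mem s) (i :: J') & uniq (i :: J')].
    by rewrite -cat_uniq.
  have JB' j : j \in J' -> B' j = B j.
    by rewrite /B'; case: eqP => // ->; rewrite (negbTE iJ).
  have mB' j : measurable (B' j) by rewrite /B'; case: ifP.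
  have := ih (i :: J') C B' uJ' mC mB'; rewrite big_cons {2}/B' eqxx muleA.
  rewrite [X in _ = (_ * X)%E -> _](_ : _ = \prod_(j <- J') P (X j @^-1` B j))%E; last first.
    by apply: eq_big_seq => j jJ; rewrite JB'.
  rewrite X_indep// => <-.
  rewrite -setIA; congr (P (_ `&` _)); apply/seteqP; split.
    move=> w [Ew Dw] j /=; rewrite inE /B'; case: eqP => [-> _|_ jJ] //=.
    exact: Dw.
  move=> w Bw; split.
    by have := Bw i; rewrite /= /B' inE !eqxx; exact.
  by move=> j jJ; rewrite -JB'//; apply: Bw; rewrite /= inE jJ orbT.
have /and4P[us usi _ /andP[iJ uJ']] :
    [&& uniq s, i \notin s, ~~ has (mem s) J & uniq (i :: J)].
  by move: uJ; rewrite cat_uniq/= negb_or -!andbA.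
have ui : uniq (s ++ [:: i]) by rewrite cats1 rcons_uniq usi.
rewrite -X_indep//; pose D := \bigcap_(j in [set` J]) X j @^-1` B j.
rewrite -/D; have mD : measurable D by exact: mbig.
have k0 : 0 <= fine (P D) by rewrite fine_ge0.
have kE : (fine (P D))%:E = P D by rewrite fineK// fin_num_measure.
pose F w := (M s w, X i w).
have mF : measurable_fun setT F.
  by apply: measurable_fun_pair => //; exact: measurable_chain.
pose F' : {mfun T >-> (S * R)%type} := HB.pack F (isMeasurableFun.Build _ _ _ _ F mF).
pose E := (fun p : S * R => step p.1 p.2) @^-1` A.
have mE : measurable E by rewrite -[X in measurable X]setTI; exact: mstep.
have -> : M (rcons s i) @^-1` A = F @^-1` E.
  by apply/seteqP; split => w; rewrite /= chain_rcons.
(* The same identity for rectangles suffices, and there it is [rect]. *)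
suff : pushforward (mrestr P mD) F E = mscale (NngNum k0) (distribution P F') E.
  by rewrite /pushforward /mrestr /mscale /= kE muleC.
apply: eq_measure_rectangles => //.
- rewrite /= /pushforward /mrestr preimage_setT setTI.
  by rewrite (le_lt_trans (probability_le1 _ _)) ?ltry.
- move=> C E' mC mE'; rewrite /= /pushforward /mrestr /mscale/= kE.
  have FE : F @^-1` (C `*` E') = M s @^-1` C `&` X i @^-1` E' by [].
  rewrite FE rect// muleC; congr (_ * _)%E; apply: esym.
  have := rect [::] C E' ui mC mE'.
  rewrite (_ : \bigcap_(_ in _) _ = setT) ?setIT; last first.
    by apply/seteqP; split => // w _ j.
  by move=> h; apply: (etrans h); rewrite [X in (_ * X)%E]probability_setT mule1.
Qed.

(** The new observation is independent of the current state, so by Fubini one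
    more step averages [u (step x y)] over [y], which gives back [u x]. *)
Lemma chain_harmonic (L : probability R R) (u : S -> \bar R) (s : seq I) :
  (forall i B, measurable B -> P (X i @^-1` B) = L B) ->
  measurable_fun setT u -> (forall x, 0 <= u x)%E ->
  (forall x, \int[L]_y u (step x y) = u x)%E ->
  uniq s -> (\int[P]_w u (M s w) = u z)%E.
Proof.
move=> XL mu u0 uE; elim/last_ind: s => [|s i ih] us.
  by rewrite /chain/= integral_cst// [X in (_ * X)%E]probability_setT mule1.
have := us; rewrite rcons_uniq => /andP[iNs us'].
pose F w := (M s w, X i w).
have mM : measurable_fun setT (M s) by exact: measurable_chain.
have mF : measurable_fun setT F by exact: measurable_fun_pair.
pose M' : {mfun T >-> S} := HB.pack (M s) (isMeasurableFun.Build _ _ _ _ (M s) mM).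
pose F' : {mfun T >-> (S * R)%type} := HB.pack F (isMeasurableFun.Build _ _ _ _ F mF).
have mX j (C : set R) : measurable C -> measurable (X j @^-1` C).
  by move=> mC; rewrite -[X in measurable X]setTI; exact: measurable_funP.
pose f (p : S * R) := u (step p.1 p.2).
have mf : measurable_fun setT f by exact: measurableT_comp mu mstep.
transitivity (\int[P]_w (f \o F) w)%E.
  by apply: eq_integral => w _; rewrite /f /= chain_rcons.
transitivity (\int[distribution P F']_p f p)%E.
  by rewrite /distribution ge0_integral_pushforward//= => p _; exact: u0.
transitivity (\int[distribution P M' \x L]_p f p)%E.
  apply: eq_measure_integral => E mE _; apply: eq_measure_rectangles => //.
    by rewrite (le_lt_trans (probability_le1 _ _)) ?ltry.
  move=> A B mA mB; rewrite [RHS]product_measure1E//.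
  have := chain_indep (s := s) (J := [:: i]) (A := A) (B := fun=> B).
  rewrite cats1 us big_seq1 XL// => /(_ isT mA (fun=> mB)) <-.
  rewrite /distribution /pushforward; congr (P _); apply/seteqP; split.
    by move=> w [Aw Bw]; split => // j; rewrite /= inE => /eqP ->.
  by move=> w [Aw /(_ i)]; rewrite /= inE eqxx => /(_ isT).
rewrite fubini_tonelli1//; last by move=> p; exact: u0.
rewrite /fubini_F /f/=; under eq_integral do rewrite uE.
rewrite /distribution ge0_integral_pushforward//=; first exact: ih.
Qed.

End independent_chain.

(** * The product chain, the record chain and their common harmonic function *)

(** Every subset of [nat] is measurable and [nat] is countable, so joint
    measurability can be checked one slice at a time. *)
Lemma measurable_fun_nat_pair d1 d2 (T1 : measurableType d1)
    (T2 : measurableType d2) (g : nat * T1 -> T2) :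
  (forall j, measurable_fun setT (fun x => g (j, x))) -> measurable_fun setT g.
Proof.
move=> mg _ B mB; rewrite setTI.
rewrite (_ : g @^-1` B
  = \bigcup_j ([set j] `*` ((fun x => g (j, x)) @^-1` B))).
  apply: bigcup_measurable => j _; apply: measurableX => //.
  by rewrite -[X in measurable X]setTI; exact: mg.
apply/seteqP; split; first by move=> [j x] Bx; exists j.
by move=> [k x] [j _ [/= -> Bx]].
Qed.

Definition product_step (R : realType) (p : nat * R) (y : R) : nat * R :=
  if (0 < p.1)%N then (p.1.-1, lomax_shift p.2 y) else p.

Definition record_step (R : realType) (p : nat * R) (y : R) : nat * R :=
  if (0 < p.1)%N && (p.2 < y) then (p.1.-1, y) else p.

(** The harmonic function: the mean of [f] at the value reached from [v] by
    [j] independent multiplications. *)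
Fixpoint mean_after_shifts (R : realType) (L : probability R R) (f : R -> \bar R)
    (j : nat) : R -> \bar R :=
  if j is j'.+1 then fun v => (\int[L]_y mean_after_shifts L f j' (lomax_shift v y))%E
  else f.

Section steps_measurable.
Context (R : realType).

Let measurable_count dU (U' : measurableType dU) (h : nat -> U') :
  measurable_fun setT (fun q : (nat * R) * R => h q.1.1).
Proof.
have mh : measurable_fun setT h by [].
have m1 : measurable_fun setT (fun q : (nat * R) * R => q.1.1).
  exact: measurableT_comp.
exact: (measurableT_comp mh m1).
Qed.

Let measurable_current : measurable_fun setT (fun q : (nat * R) * R => q.1.2).
Proof. exact: (measurableT_comp measurable_snd measurable_fst). Qed.

Lemma measurable_product_step :
  measurable_fun setT (fun q : (nat * R) * R => product_step q.1 q.2).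
Proof.
apply: measurable_fun_ifT => //.
  exact: (measurable_count (fun k => 0 < k)%N).
apply: measurable_fun_pair => //.
have mq : measurable_fun setT (fun q : (nat * R) * R => (q.1.2, q.2)).
  exact: measurable_fun_pair.
exact: (measurableT_comp (@measurable_lomax_shift R) mq).
Qed.

Lemma measurable_record_step :
  measurable_fun setT (fun q : (nat * R) * R => record_step q.1 q.2).
Proof.
apply: measurable_fun_ifT => //.
- apply: measurable_and; first exact: (measurable_count (fun k => 0 < k)%N).
  exact: measurable_fun_ltr.
- exact: measurable_fun_pair.
Qed.

End steps_measurable.

Section mean_after_shifts.
Context (R : realType) (theta : R) (L : probability R R) (f : R -> \bar R).
Hypothesis theta_gt0 : 0 < theta.
Hypothesis L_lomax : forall B : set R, measurable B -> L B = lomax_prob theta B.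
Hypothesis mf : measurable_fun setT f.
Hypothesis f_ge0 : forall x, (0 <= f x)%E.

Local Notation u := (mean_after_shifts L f).

Lemma mean_after_shifts_ge0 j v : (0 <= u j v)%E.
Proof. by elim: j v => //= j ih v; apply: integral_ge0. Qed.

Lemma measurable_mean_after_shifts j : measurable_fun setT (u j).
Proof.
elim: j => //= j ih.
pose h (p : R * R) := u j (lomax_shift p.1 p.2).
apply: (@measurable_fun_fubini_tonelli_F _ _ _ _ _ L h).
  exact: measurableT_comp ih (@measurable_lomax_shift R).
by move=> p; exact: mean_after_shifts_ge0.
Qed.

Lemma measurable_mean_after_shifts_pair :
  measurable_fun setT (fun p : nat * R => u p.1 p.2).
Proof. by apply: measurable_fun_nat_pair => j; exact: measurable_mean_after_shifts. Qed.

Lemma mean_after_shifts_le1 j v : (forall x, f x <= 1)%E -> (u j v <= 1)%E.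
Proof.
move=> f1; elim: j v => [|j ih] v //=.
rewrite -[leRHS](mul1e 1%E) -[X in (_ * X)%E](@probability_setT _ _ _ L).
rewrite -(@integral_cst _ _ _ L setT)//; apply: ge0_le_integral => //.
- by move=> y _; exact: mean_after_shifts_ge0.
- apply: measurableT_comp (measurable_mean_after_shifts j) _.
  exact: measurable_lomax_shiftr.
Qed.

Lemma product_step_harmonic p :
  (\int[L]_y u (product_step p y).1 (product_step p y).2 = u p.1 p.2)%E.
Proof.
by case: p => -[|j] v //=; rewrite integral_cst// [X in (_ * X)%E]probability_setT mule1.
Qed.

Lemma record_step_harmonic p :
  (\int[L]_y u (record_step p y).1 (record_step p y).2 = u p.1 p.2)%E.
Proof.
case: p => -[|j] v /=.
  by rewrite integral_cst// [X in (_ * X)%E]probability_setT mule1.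
rewrite -[RHS](integral_lomax_record theta_gt0 L_lomax)//; last 2 first.
- exact: measurable_mean_after_shifts.
- by move=> y; exact: mean_after_shifts_ge0.
by apply: eq_integral => y _; rewrite /record_step/=; case: ifP.
Qed.

End mean_after_shifts.

(** * The law of the product of a sample *)

Lemma ae_gt0_lomax (R : realType) (theta : R) (L : probability R R)
    d (T : measurableType d) (P : probability T R) (X : {RV P >-> R}) :
  0 < theta ->
  (forall B : set R, measurable B -> L B = lomax_prob theta B) ->
  has_lomax_law theta X ->
  {ae P, forall w, 0 < X w}.
Proof.
move=> theta_gt0 L_lomax lawX; exists (X @^-1` `]-oo, 0]); split.
- by rewrite -[X in measurable X]setTI; exact: measurable_funP.
- have <- : L `]-oo, 0]%classic = 0%E.
    rewrite -setCitvr probability_setC// (lomax_tail theta_gt0)//.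
    by rewrite maxxx addr0 powR1 subee.
  by have := lawX `]-oo, 0]%classic; rewrite -L_lomax//; exact.
- by move=> w /negP; rewrite -leNgt /= in_itv/=.
Qed.

(** Started at [0], the chain computes the product as long as the factors
    exceed [1]: its values then stay nonnegative and no truncation occurs. *)
Lemma product_chainE (R : realType) (T I : Type) (X : I -> T -> R) (n : nat)
    (w : T) (s : seq I) :
  (forall i, 0 < X i w) -> (size s <= n)%N ->
  chain (@product_step R) (n, 0) X s w
    = ((n - size s)%N, \prod_(i <- s) (1 + X i w) - 1).
Proof.
move=> X0; elim/last_ind: s => [|s i ih] sn.
  by rewrite big_nil subrr subn0.
rewrite size_rcons in sn *; rewrite chain_rcons ih 1?ltnW//.
rewrite /product_step/= subn_gt0 sn subnS; congr (_, _).
rewrite big_rcons/= /lomax_shift max_l ?subrKC// subr_ge0.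
elim: s {ih sn} => [|j s ih]; first by rewrite big_nil.
by rewrite big_cons mulr_ege1// lerDl ltW.
Qed.

Lemma iid_lomax_law (R : realType) (theta : R) (L : probability R R)
    d (T : measurableType d) (P : probability T R) (I : eqType)
    (X : I -> {RV P >-> R}) (i : I) (B : set R) :
  (forall B : set R, measurable B -> L B = lomax_prob theta B) ->
  iid_lomax theta X -> measurable B -> P (X i @^-1` B) = L B.
Proof. by move=> LL [_ lawX] mB; rewrite LL//; have h := lawX i; exact: h. Qed.

Section sample_law.
Context (R : realType) (theta : R) (L : probability R R).
Hypothesis theta_gt0 : 0 < theta.
Hypothesis L_lomax : forall B : set R, measurable B -> L B = lomax_prob theta B.
Context d (T : measurableType d) (P : probability T R) (n : nat)
  (X : 'I_n -> {RV P >-> R}).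
Hypothesis X_iid : iid_lomax theta X.

Lemma ae_gt0_sample : {ae P, forall w, forall i, 0 < X i w}.
Proof.
apply: filter_forall => i.
have h := X_iid.2 i; exact: ae_gt0_lomax theta_gt0 L_lomax h.
Qed.

(** After [n] observations the counter is [0], where the harmonic function
    is [f] itself. *)
Lemma expectation_sample_prod (f : R -> \bar R) :
  measurable_fun setT f -> (forall x, 0 <= f x)%E ->
  (\int[P]_w f (\prod_(i < n) (1 + X i w) - 1)%R = mean_after_shifts L f n 0%R)%E.
Proof.
move=> mf f0.
pose u (p : nat * R) := mean_after_shifts L f p.1 p.2.
have mu : measurable_fun setT u by exact: measurable_mean_after_shifts_pair.
have u0 p : (0 <= u p)%E by exact: mean_after_shifts_ge0.
rewrite -[RHS]/(u (n, 0)).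
rewrite -(chain_harmonic (S := (nat * R)%type) (n, 0 : R) X_iid.1 (@measurable_product_step R)
  (L := L) (u := u) (s := index_enum 'I_n))//; last 3 first.
- by move=> i B; exact: iid_lomax_law L_lomax X_iid.
- by move=> p; exact: product_step_harmonic.
- exact: index_enum_uniq.
apply: ge0_ae_eq_integral => //.
- apply: measurableT_comp mf _; apply: measurable_funB => //.
  apply: measurable_prod => i _; exact: measurable_funD.
- apply: measurableT_comp mu _; apply: measurable_chain.
  exact: measurable_product_step.
apply: filterS ae_gt0_sample => w Xw _.
have sE : size (index_enum 'I_n) = n by rewrite -[RHS]card_ord cardT enumT.
by rewrite /u product_chainE ?sE// subnn.
Qed.

End sample_law.

(** * Records along a path *)

Section record_path.
Context (R : realType) (y : nat -> R).

Lemma next_record_timeP (t : nat) : (exists j, (t < j)%N && (y t < y j)) ->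
  [/\ (t < next_record_time y t)%N, y t < y (next_record_time y t) &
      forall j, (t < j < next_record_time y t)%N -> y j <= y t].
Proof.
move=> ex; rewrite /next_record_time; case: pselect => // {}ex.
case: ex_minnP => N /andP[tN yN] minN; split => // j /andP[tj jN].
by rewrite leNgt; apply/negP => yj; have := minN j; rewrite tj yj leqNgt jN => /(_ isT).
Qed.

Lemma unbounded_next_record (t : nat) :
  (forall c : nat, exists j, c%:R < y j) -> exists j, (t < j)%N && (y t < y j).
Proof.
move=> unb; have [c yc] : exists c : nat, forall i, (i <= t)%N -> y i <= c%:R.
  elim: t => [|t [c yc]].
    exists (Num.bound `|y 0%N|) => i; rewrite leqn0 => /eqP ->.
    by rewrite (le_trans (ler_norm _))// ltW// archi_boundP.
  exists (maxn c (Num.bound `|y t.+1|)) => i.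
  rewrite leq_eqVlt => /predU1P[->|/yc yic].
    rewrite (le_trans (ler_norm _))// ltW// (lt_le_trans (archi_boundP _))//.
    by rewrite ler_nat leq_maxr.
  by rewrite (le_trans yic)// ler_nat leq_maxl.
(* A value above a bound [c] of the values up to time [t] comes after [t]. *)
have [j cj] := unb c; exists j; rewrite (le_lt_trans (yc t _) cj)// andbT.
by rewrite ltnNge; apply/negP => /yc; rewrite leNgt cj.
Qed.

Local Notation state n m := (foldl (@record_step R) (n, 0) [seq y i | i <- iota 0 m]).

Let stateS n m : state n m.+1 = record_step (state n m) (y m).
Proof. by rewrite -addn1 iotaD map_cat foldl_cat. Qed.

Let state_stable n m0 k v m : state n m0 = (k, v) -> (m0 <= m)%N ->
  (forall j, (m0 <= j < m)%N -> y j <= v) -> state n m = (k, v).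
Proof.
move=> st0; elim: m => [|m ih]; first by rewrite leqn0 => /eqP m00; move: st0; rewrite m00.
rewrite leq_eqVlt => /predU1P[<- //|]; rewrite ltnS => m0m yv.
rewrite stateS ih//; last first.
  by move=> j /andP[m0j jm]; apply: yv; rewrite m0j ltnS ltnW.
by rewrite /record_step /= ltNge yv ?m0m ?ltnSn //= andbF.
Qed.

(** Between two record times no observation exceeds the current record, so
    the chain is at rest there.  The first observation is a record for the
    chain because it exceeds the initial value [0]. *)
Lemma record_chain_at_record n k : 0 < y 0%N ->
  (forall c : nat, exists j, c%:R < y j) -> (k < n)%N ->
  state n (record_time y k.+1).+1 = ((n - k.+1)%N, record_value y k.+1).
Proof.
move=> y0 unb; elim: k => [|k ih] kn.
  by rewrite stateS /record_step /= kn y0 subn1.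
have [tN yN minN] := next_record_timeP (unbounded_next_record (record_time y k.+1) unb).
have next : record_time y k.+2 = next_record_time y (record_time y k.+1) by [].
rewrite stateS /record_value next.
rewrite (state_stable (ih (ltnW kn)) tN)//.
move: yN; rewrite /record_step /record_value /= subn_gt0 kn => -> /=.
by rewrite -subnS.
Qed.

Lemma record_chain_final n m : 0 < y 0%N ->
  (forall c : nat, exists j, c%:R < y j) -> (0 < n)%N ->
  (record_time y n < m)%N -> state n m = (0%N, record_value y n).
Proof.
case: n => // n y0 unb _ nm.
have := record_chain_at_record y0 unb (ltnSn n); rewrite subnn => st.
elim: m nm => // m ih; rewrite ltnS leq_eqVlt => /predU1P[<- //|/ih stm].
by rewrite stateS stm.
Qed.

End record_path.

Section record_measurability.
Context (R : realType) d (T : measurableType d) (Y : nat -> T -> R).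
Hypothesis mY : forall i, measurable_fun setT (Y i).

Let measurable_le i j : measurable [set w | Y i w <= Y j w].
Proof.
rewrite (_ : [set _ | _] = (fun w => Y i w <= Y j w) @^-1` [set true]); last first.
  by apply/seteqP; split => w.
rewrite -[X in measurable X]setTI.
have : measurable_fun setT (fun w => Y i w <= Y j w) by exact: measurable_fun_ler.
exact.
Qed.

(** Expresses the event that the next record time is [b], the dummy value [t]
    included, by comparisons of observations; measurability follows from it. *)
Lemma next_record_timeE (y : nat -> R) (t b : nat) :
  next_record_time y t = b <->
  ((b = t /\ forall j, (t < j)%N -> y j <= y t) \/
   [/\ (t < b)%N, ~ y b <= y t & forall j, (t < j < b)%N -> y j <= y t]).
Proof.
have [ex|nex] := pselect (exists j, (t < j)%N && (y t < y j)).
  have [tN yN minN] := next_record_timeP ex.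
  split => [<-|[[bt yt]|[tb yb yt]]].
  - by right; split => //; apply/negP; rewrite -ltNge.
  - by move: yN; rewrite ltNge yt.
  - apply/eqP; rewrite eqn_leq leqNgt; apply/andP; split.
      by apply/negP => bN; apply: yb; apply: minN; rewrite tb.
    by rewrite leqNgt; apply/negP => Nb; move: yN; rewrite ltNge yt// tN.
have nextE : next_record_time y t = t by rewrite /next_record_time; case: pselect.
have yt j : (t < j)%N -> y j <= y t.
  by move=> tj; rewrite leNgt; apply/negP => yj; apply: nex; exists j; rewrite tj.
rewrite nextE; split => [<-|[[]//|[tb yb _]]]; first by left.
by case: yb; exact: yt.
Qed.

Let next w t := next_record_time (fun i => Y i w) t.

Let measurable_next t : measurable_fun setT (fun w => next w t).
Proof.
move=> _ B _; rewrite setTI.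
rewrite (_ : _ @^-1` B = \bigcup_(b in B) ([set w | next w t = b])); last first.
  by apply/seteqP; split => [w Bw|w [b Bb /= ->//]]; exists (next w t).
apply: bigcup_measurable => b _.
rewrite (_ : [set _ | _] =
  ([set w | b = t] `&` \bigcap_(j in [set j | t < j]%N) [set w | Y j w <= Y t w])
  `|` ([set w | (t < b)%N] `&` ~` [set w | Y b w <= Y t w] `&`
    \bigcap_(j in [set j | t < j < b]%N) [set w | Y j w <= Y t w])); last first.
  apply/seteqP; split => w.
    by move=> /next_record_timeE[[]|[]]; [left|right].
  by move=> [[bt h]|[[tb yb] h]]; apply/next_record_timeE; [left|right].
have mcst (Q : Prop) : measurable [set _ : T | Q].
  have [q|q] := pselect Q.
    by rewrite (_ : [set _ | _] = setT)//; apply/seteqP; split.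
  by rewrite (_ : [set _ | _] = set0)//; apply/seteqP; split.
apply: measurableU; apply: measurableI => //.
- by apply: bigcap_measurableType => j _.
- by apply: measurableI => //; exact: measurableC.
- by apply: bigcap_measurableType => j _.
Qed.

Lemma measurable_record_time k :
  measurable_fun setT (fun w => record_time (fun i => Y i w) k.+1).
Proof.
elim: k => [|k ih]; first exact: measurable_cst.
have mn : measurable_fun setT (fun p : nat * T => next p.2 p.1).
  by apply: measurable_fun_nat_pair => t; exact: measurable_next.
have mp : measurable_fun setT
    (fun w => (record_time (fun i => Y i w) k.+1, w)).
  by apply: measurable_fun_pair.
exact: (measurableT_comp mn mp).
Qed.

(** The observations form a function of the pair (time, outcome), to which a
    measurable random time can be substituted. *)
Lemma measurable_record_value k :
  measurable_fun setT (fun w => record_value (fun i => Y i w) k.+1).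
Proof.
have mY' : measurable_fun setT (fun p : nat * T => Y p.1 p.2).
  by apply: measurable_fun_nat_pair.
have mp : measurable_fun setT
    (fun w => (record_time (fun i => Y i w) k.+1, w)).
  by apply: measurable_fun_pair => //; exact: measurable_record_time.
exact: (measurableT_comp mY' mp).
Qed.

End record_measurability.

(** * The law of the records *)

Section record_law.
Context (R : realType) (theta : R) (L : probability R R).
Hypothesis theta_gt0 : 0 < theta.
Hypothesis L_lomax : forall B : set R, measurable B -> L B = lomax_prob theta B.
Context d (T : measurableType d) (P : probability T R) (Y : nat -> {RV P >-> R}).
Hypothesis Y_iid : iid_lomax theta Y.

(** The first [m] observations are all at most [c] with probability [q ^+ m],
    where [q < 1] since the tail never vanishes. *)
Lemma ae_unbounded_lomax :
  {ae P, forall w, forall c : nat, exists j, c%:R < Y j w}.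
Proof.
apply: ae_foralln => c; pose A : set R := `]-oo, c%:R]%classic.
have mA : measurable A by exact: measurable_itv.
have mY j : measurable (Y j @^-1` A).
  by rewrite -[X in measurable X]setTI; exact: measurable_funP.
pose q : R := 1 - (1 + Num.max (c%:R : R) 0) `^ (- theta^-1).
have LA : L A = q%:E.
  by rewrite /A -setCitvr probability_setC// (lomax_tail theta_gt0).
have q0 : 0 <= q by rewrite -lee_fin -LA measure_ge0.
have q1 : q < 1.
  rewrite /q ltrBlDr ltrDl powR_gt0// ltr_pwDl// le_max lexx orbT//.
have Pq m : (P (\bigcap_j Y j @^-1` A) <= (q ^+ m)%:E)%E.
  have prodE (s : seq nat) : (\prod_(j <- s) P (Y j @^-1` A) = (q ^+ size s)%:E)%E.
    elim: s => [|j s ih]; first by rewrite big_nil expr0.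
    by rewrite big_cons ih (iid_lomax_law j L_lomax Y_iid)// LA -EFinM -exprS.
  rewrite -[X in q ^+ X](size_iota 0) -prodE -(Y_iid.1 _ (fun=> A))//; last exact: iota_uniq.
  apply: le_measure; rewrite ?inE//.
  - exact: bigcap_measurableType.
  - exact: bigcap_measurableType.
  - by move=> w Yw j _; exact: Yw.
have mN : measurable (\bigcap_j Y j @^-1` A) by exact: bigcap_measurableType.
have P0 : P (\bigcap_j Y j @^-1` A) = 0%E.
  have Pfin : P (\bigcap_j Y j @^-1` A) \is a fin_num by rewrite fin_num_measure.
  apply/eqP; rewrite eq_le measure_ge0 andbT -(fineK Pfin) lee_fin.
  apply: (@cvgr_to_ge _ \oo _ _ (fun m => q ^+ m)).
    by apply: cvg_expr; rewrite ger0_norm.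
  by apply: nearW => m; rewrite -lee_fin fineK.
exists (\bigcap_j Y j @^-1` A); split => //.
move=> w /= nw j _; rewrite /A/= in_itv/= leNgt; apply/negP => cY.
by apply: nw; exists j.
Qed.

(** The mean of the harmonic function is the same after any number [m] of
    observations.  As [m] grows the chain is almost surely absorbed at
    [(0, R_n)]; the bound [f <= 1] passes to the harmonic function and allows
    the limit to be taken under the integral. *)
Lemma expectation_record_value (n : nat) (f : R -> \bar R) :
  (0 < n)%N -> measurable_fun setT f -> (forall x, 0 <= f x)%E ->
  (forall x, f x <= 1)%E ->
  (\int[P]_w f (record_value (fun i => Y i w) n) = mean_after_shifts L f n 0%R)%E.
Proof.
move=> n0 mf f0 f1.
pose u (p : nat * R) := mean_after_shifts L f p.1 p.2.
have mu : measurable_fun setT u by exact: measurable_mean_after_shifts_pair.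
have u0 p : (0 <= u p)%E by exact: mean_after_shifts_ge0.
pose st m w := chain (@record_step R) (n, 0) Y (iota 0 m) w.
have ust m : (\int[P]_w u (st m w) = mean_after_shifts L f n 0%R)%E.
  rewrite -[RHS]/(u (n, 0)).
  rewrite -(chain_harmonic (S := (nat * R)%type) (n, 0 : R) Y_iid.1
    (@measurable_record_step R) (L := L) (u := u) (s := iota 0 m))//.
  - by move=> i B; exact: iid_lomax_law L_lomax Y_iid.
  - by move=> p; exact: (record_step_harmonic theta_gt0 L_lomax).
  - exact: iota_uniq.
have mst m : measurable_fun setT (fun w => u (st m w)).
  apply: measurableT_comp mu _; apply: measurable_chain.
  exact: measurable_record_step.
have mR : measurable_fun setT (fun w => f (record_value (fun i => Y i w) n)).
  apply: measurableT_comp mf _.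
  have := @measurable_record_value _ _ _ (fun i => Y i : T -> R) _ n.-1.
  by rewrite prednK//; apply.
have cvg_st : {ae P, forall w, setT w ->
    (u (st m w)) @[m --> \oo] --> f (record_value (fun i => Y i w) n)}.
  have Y0 : {ae P, forall w, 0 < Y 0%N w}.
    by have h := Y_iid.2 0%N; exact: ae_gt0_lomax theta_gt0 L_lomax h.
  apply: filterS2 Y0 ae_unbounded_lomax => w Yw0 unb _.
  apply: cvg_near_cst; near=> m.
  rewrite /st /chain (record_chain_final (y := fun i => Y i w) Yw0 unb n0)//.
  by near: m; exact: nbhs_infty_gt.
have int1 : P.-integrable setT (cst 1%E) by exact: finite_measure_integrable_cst.
have dom : {ae P, forall w m, setT w -> (`|u (st m w)| <= cst 1 w)%E}.
  by apply: aeW => w m _; rewrite gee0_abs//; exact: mean_after_shifts_le1.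
have [_ _] := dominated_convergence measurableT mst mR cvg_st int1 dom.
rewrite (_ : (fun _ => _) = cst (mean_after_shifts L f n 0)); last exact/funext.
by move=> /cvg_lim <-//; rewrite lim_cst.
Unshelve. all: by end_near. Qed.

End record_law.

(** * Equality in law of the estimators *)

Lemma same_distribution_integral (R : realType) d d' (T : measurableType d)
    (T' : measurableType d') (P : probability T R) (P' : probability T' R)
    (S : T -> R) (S' : T' -> R) (f : R -> \bar R) :
  same_distribution P P' S S' ->
  measurable_fun setT f -> (forall x, 0 <= f x)%E ->
  (\int[P]_w f (S w) = \int[P']_w f (S' w))%E.
Proof.
move=> [mS mS' SS'] mf f0.
rewrite -[LHS](ge0_integral_pushforward mS P measurableT mf)//.
rewrite -[RHS](ge0_integral_pushforward mS' P' measurableT mf)//.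
by apply: eq_measure_integral => A mA _; exact: SS'.
Qed.

Lemma same_distribution_mse (R : realType) d d' (T : measurableType d)
    (T' : measurableType d') (P : probability T R) (P' : probability T' R)
    (S : T -> R) (S' : T' -> R) (a : R) :
  same_distribution P P' S S' -> mse P S a = mse P' S' a.
Proof.
move=> SS'; rewrite /mse unlock.
pose f (x : R) := ((x - a) ^+ 2)%:E.
apply: (@same_distribution_integral _ _ _ _ _ _ _ _ _ f SS').
  by apply/measurable_EFinP; apply: measurable_funX; exact: measurable_funB.
by move=> x; rewrite lee_fin sqr_ge0.
Qed.

Lemma integral_indic_comp (R : realType) d (T : measurableType d)
    (P : probability T R) (S : T -> R) (B : set R) :
  measurable_fun setT S -> measurable B ->
  (\int[P]_w (\1_B (S w) : R)%:E = P (S @^-1` B))%E.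
Proof.
move=> mS mB; rewrite -[X in _ = P X]setIT -integral_indic//.
by rewrite -[X in measurable X]setTI; exact: mS.
Qed.

Section estimators_law.
Context (R : realType) (theta : R) (n : nat).
Hypotheses (theta_gt0 : 0 < theta) (n_gt0 : (0 < n)%N).
Context d (T : measurableType d) (P : probability T R) (X : 'I_n -> {RV P >-> R}).
Hypothesis X_iid : iid_lomax theta X.
Context d' (T' : measurableType d') (P' : probability T' R)
  (Y : nat -> {RV P' >-> R}).
Hypothesis Y_iid : iid_lomax theta Y.

(** Positivity is what turns the sum of logarithms into the logarithm of the
    product, since [ln] is [0] on nonpositive numbers. *)
Lemma theta_sampleE w : (forall i, 0 < X i w) ->
  theta_sample X w = ln (1 + (\prod_(i < n) (1 + X i w) - 1)) / n%:R.
Proof.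
move=> Xw; rewrite /theta_sample mulrC subrKC; congr (_ / _).
have X1 i : 0 < 1 + X i w by rewrite addr_gt0.
apply/esym/(big_morph_in Num.pos) => //; first exact: rpredM.
- exact: rpred1.
- exact: lnM.
- exact: ln1.
- by move=> i _; rewrite posrE.
Qed.

Lemma measurable_theta_sample : measurable_fun setT (theta_sample X).
Proof.
apply: measurable_funM => //; apply: measurable_sum => i.
by apply: measurableT_comp => //; exact: measurable_funD.
Qed.

Lemma measurable_theta_records : measurable_fun setT (theta_records n Y).
Proof.
apply: measurable_funM => //; apply: measurableT_comp => //.
apply: measurable_funD => //.
have := @measurable_record_value _ _ _ (fun i => Y i : T' -> R) _ n.-1.
by rewrite prednK//; apply.
Qed.

(** Both probabilities are means of the same bounded function [f] of the record
    and of the product, hence equal [mean_after_shifts L f n 0], where the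
    Lomax law [L] is represented by the law of the first [Y]. *)
Lemma same_distribution_theta :
  same_distribution P' P (theta_records n Y) (theta_sample X).
Proof.
split; [exact: measurable_theta_records|exact: measurable_theta_sample|].
move=> B mB; rewrite /pushforward.
pose L : probability R R := distribution P' (Y 0%N).
have L_lomax (C : set R) : measurable C -> L C = lomax_prob theta C.
  by have h := Y_iid.2 0%N; exact: h.
pose f (r : R) : \bar R := (\1_B (ln (1 + r) / n%:R))%:E.
have mf : measurable_fun setT f.
  apply/measurable_EFinP; apply: measurableT_comp; first exact: measurable_indic.
  apply: measurable_funM => //; apply: measurableT_comp => //.
  exact: measurable_funD.
have f0 r : (0 <= f r)%E by rewrite lee_fin.
have f1 r : (f r <= 1)%E by rewrite lee_fin indicE lern1 leq_b1.
rewrite -(integral_indic_comp P' measurable_theta_records mB).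
rewrite -(integral_indic_comp P measurable_theta_sample mB).
rewrite [LHS](expectation_record_value theta_gt0 L_lomax Y_iid n_gt0 mf f0 f1).
rewrite -(expectation_sample_prod theta_gt0 L_lomax X_iid mf f0).
apply: ge0_ae_eq_integral => //.
- apply: measurableT_comp mf _; apply: measurable_funB => //.
  by apply: measurable_prod => i _; exact: measurable_funD.
- apply/measurable_EFinP; apply: measurableT_comp; first exact: measurable_indic.
  exact: measurable_theta_sample.
have Xpos := ae_gt0_sample theta_gt0 L_lomax X_iid.
apply: filterS Xpos => w Xw _.
by rewrite /f theta_sampleE.
Qed.

End estimators_law.

Lemma same_distribution_comp (R : realType) d d' (T : measurableType d)
    (T' : measurableType d') (P : probability T R) (P' : probability T' R)
    (S : T -> R) (S' : T' -> R) (h : R -> R) :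
  measurable_fun setT h -> same_distribution P P' S S' ->
  same_distribution P P' (h \o S) (h \o S').
Proof.
move=> mh [mS mS' SS']; split; [exact: measurableT_comp|exact: measurableT_comp|].
move=> B mB; apply: (SS' (h @^-1` B)).
by rewrite -[X in measurable X]setTI; exact: mh.
Qed.

Theorem theorem1 (R : realType) (theta : R) (theta_gt0 : 0 < theta)
    (n : nat) (n_ge1 : (1 <= n)%N)
    (d : measure_display) (T : measurableType d) (P : probability T R)
    (X : 'I_n -> {RV P >-> R}) (X_iid : iid_lomax theta X)
    (d' : measure_display) (T' : measurableType d') (P' : probability T' R)
    (Y : nat -> {RV P' >-> R}) (Y_iid : iid_lomax theta Y)
    (g : R -> R) (g_meas : measurable_fun (`]0, +oo[ : set R) g)
    (g_inj : {in (`]0, +oo[ : interval R) &, injective g}) :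
  same_distribution P' P (comp_pos g (theta_records n Y))
                         (comp_pos g (theta_sample X))
  /\
  mse P' (comp_pos g (theta_records n Y)) (g theta)
    = mse P (comp_pos g (theta_sample X)) (g theta).
Proof.
have mg : measurable_fun setT (g \_ `]0, +oo[%classic).
  by have [+ _] := measurable_restrictT g (measurable_itv `]0, +oo[); apply.
have gg := same_distribution_comp mg
  (same_distribution_theta theta_gt0 n_ge1 X_iid Y_iid).
by split; [exact: gg|exact: same_distribution_mse gg].
Qed.
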